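(* Let $\mathcal{C}$ be a category with weak pullbacks, equipped with a quasi Grothendieck topology. Suppose that the commutative square given by $\varphi':X'\to X$, $f':X'\to Y'$, $f:X\to Y$, $\varphi:Y'\to Y$ (with $f\circ\varphi'=\varphi\circ f'$) is a weak pullback in $\mathcal{C}$. Then: (1) $\mathrm{sec}(f')\leq\mathrm{sec}(f)$. (2) If moreover $\mathcal{C}$ is a category with pullbacks, then $\mathrm{msec}(f')\leq\mathrm{msec}(f)$.
   Context: Weak pullback: a commutative square $f\circ\varphi'=\varphi\circ f'$ with $\varphi':X'\to X$, $f':X'\to Y'$, $f:X\to Y$, $\varphi:Y'\to Y$ is a weak pullback if for any $\alpha:Z\to Y'$, $\beta:Z\to X$ with $\varphi\circ\alpha=f\circ\beta$ there is a (not necessarily unique) $h:Z\to X'$ with $f'\circ h=\alpha$ and $\varphi'\circ h=\beta$. $\mathcal{C}$ is a category with weak pullbacks if every pair of morphisms $f:X\to Y$, $\varphi:Y'\to Y$ can be completed to a weak pullback square. Sieves and covers: for an object $C$, the overcategory $\mathcal{C}_{|C}$ has as objects the morphisms with codomain $C$. A sieve on $C$ is a full subcategory $S\subset\mathcal{C}_{|C}$ (i.e. a class of morphisms with codomain $C$) such that $f\in S$ implies $f\circ g\in S$ for every $g$ with $\mathrm{codom}(g)=\mathrm{dom}(f)$. For $f:D\to C$ and a sieve $S$ on $C$, the pullback $f^\ast S$ is the sieve on $D$ of all $g:E\to D$ with $f\circ g\in S$. The sieve generated by a family $\{f_i:C_i\to C\}_{i\in I}$ consists of all $g:D\to C$ that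 factor as $D\to C_i\xrightarrow{f_i}C$ for some $i\in I$. A quasi Grothendieck topology on $\mathcal{C}$ assigns to each object $C$ a collection of sieves on $C$, called covering sieves, such that (T1) $\mathcal{C}_{|C}$ is a covering sieve on $C$ for each $C$; (T2) for each $f:D\to C$ and each covering sieve $S$ on $C$, $f^\ast S$ is a covering sieve on $D$. A family $\{f_i:C_i\to C\}_{i\in I}$ is a covering for $C$ if it generates a covering sieve on $C$. Sectional number: for $f:X\to Y$ and $g:Z\to Y$, a $g$-section of $f$ is a morphism $s:Z\to X$ with $f\circ s=g$. $\mathrm{sec}(f)$ is the least integer $m\ge1$ such that there is a covering $\{g_j:Y_j\to Y\}_{j=1}^m$ for $Y$ such that $f$ admits a $g_j$-section for each $j$; $\mathrm{msec}(f)$ is defined in the same way with the additional requirement that each $g_j$ is a monomorphism. Each is $\infty$ if no such $m$ exists. *)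

(* Defs.v *)
From mathcomp Require Import all_boot all_order all_algebra.
From mathcomp Require Import boolp constructive_ereal.

Set Implicit Arguments.
Unset Strict Implicit.
Unset Printing Implicit Defensive.

Record category := Category {
  obj :> Type;
  mor : obj -> obj -> Type;
  mid : forall X : obj, mor X X;
  mcomp : forall X Y Z : obj, mor Y Z -> mor X Y -> mor X Z;
  mcomp_idl : forall (X Y : obj) (f : mor X Y), mcomp (mid Y) f = f;
  mcomp_idr : forall (X Y : obj) (f : mor X Y), mcomp f (mid X) = f;
  mcompA : forall (W X Y Z : obj) (h : mor Y Z) (g : mor X Y) (f : mor W X),
    mcomp h (mcomp g f) = mcomp (mcomp h g) f
}.

Declare Scope cat_scope.
Delimit Scope cat_scope with cat.
Notation "g ∘ f" := (mcomp g f) (at level 40, left associativity) : cat_scope.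
Local Open Scope cat_scope.

Definition monomorphism (C : category) (X Y : C) (g : mor X Y) : Prop :=
  forall (Z : C) (a b : mor Z X), g ∘ a = g ∘ b -> a = b.

(* In the squares below, the arguments are
      X' --phi'--> X
      |            |
      f'           f
      v            v
      Y' --phi---> Y *)
Definition weak_pullback (C : category) (X' X Y' Y : C)
    (phi' : mor X' X) (f' : mor X' Y') (f : mor X Y) (phi : mor Y' Y) : Prop :=
  f ∘ phi' = phi ∘ f' /\
  forall (Z : C) (a : mor Z Y') (b : mor Z X), phi ∘ a = f ∘ b ->
    exists h : mor Z X', f' ∘ h = a /\ phi' ∘ h = b.

Definition pullback (C : category) (X' X Y' Y : C)
    (phi' : mor X' X) (f' : mor X' Y') (f : mor X Y) (phi : mor Y' Y) : Prop :=
  f ∘ phi' = phi ∘ f' /\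
  forall (Z : C) (a : mor Z Y') (b : mor Z X), phi ∘ a = f ∘ b ->
    exists! h : mor Z X', f' ∘ h = a /\ phi' ∘ h = b.

Definition has_weak_pullbacks (C : category) : Prop :=
  forall (X Y' Y : C) (f : mor X Y) (phi : mor Y' Y),
    exists (X' : C) (phi' : mor X' X) (f' : mor X' Y'),
      weak_pullback phi' f' f phi.

Definition has_pullbacks (C : category) : Prop :=
  forall (X Y' Y : C) (f : mor X Y) (phi : mor Y' Y),
    exists (X' : C) (phi' : mor X' X) (f' : mor X' Y'),
      pullback phi' f' f phi.

(* Two sieves with the same members are equal, by functional and propositional
   extensionality and proof irrelevance. *)
Record sieve (C : category) (X : C) := Sieve {
  in_sieve : forall D : C, mor D X -> Prop;
  sieve_closed : forall (D E : C) (f : mor D X) (g : mor E D),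
    in_sieve f -> in_sieve (f ∘ g)
}.

Definition max_sieve (C : category) (X : C) : sieve X :=
  @Sieve C X (fun D f => True) (fun _ _ _ _ _ => I).

Lemma pullback_sieve_closed (C : category) (D X : C) (f : mor D X)
    (S : sieve X) (E F : C) (g : mor E D) (k : mor F E) :
  in_sieve S (f ∘ g) -> in_sieve S (f ∘ (g ∘ k)).
Proof. by rewrite mcompA; apply: sieve_closed. Qed.

Definition pullback_sieve (C : category) (D X : C) (f : mor D X)
    (S : sieve X) : sieve D :=
  @Sieve C D (fun E g => in_sieve S (f ∘ g)) (@pullback_sieve_closed C D X f S).

Definition factors_through (C : category) (X : C) (I : Type) (D : I -> C)
    (f : forall i, mor (D i) X) (E : C) (g : mor E X) : Prop :=
  exists (i : I) (k : mor E (D i)), g = f i ∘ k.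

Lemma factors_through_closed (C : category) (X : C) (I : Type) (D : I -> C)
    (f : forall i, mor (D i) X) (E F : C) (g : mor E X) (k : mor F E) :
  factors_through f g -> factors_through f (g ∘ k).
Proof. by move=> [i [l ->]]; exists i, (l ∘ k); rewrite mcompA. Qed.

Definition generated_sieve (C : category) (X : C) (I : Type) (D : I -> C)
    (f : forall i, mor (D i) X) : sieve X :=
  @Sieve C X (@factors_through C X I D f) (@factors_through_closed C X I D f).

Record quasi_topology (C : category) := QuasiTopology {
  covering_sieve : forall X : C, sieve X -> Prop;
  covering_max : forall X : C, covering_sieve (max_sieve X);
  covering_pullback : forall (D X : C) (f : mor D X) (S : sieve X),
    covering_sieve S -> covering_sieve (pullback_sieve f S)
}.

Definition covering (C : category) (J : quasi_topology C) (X : C) (I : Type)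
    (D : I -> C) (f : forall i, mor (D i) X) : Prop :=
  covering_sieve J (generated_sieve f).

Definition has_section_along (C : category) (X Y Z : C) (f : mor X Y)
    (g : mor Z Y) : Prop :=
  exists s : mor Z X, f ∘ s = g.

Definition sec_cover (C : category) (J : quasi_topology C) (X Y : C)
    (f : mor X Y) (m : nat) : Prop :=
  exists (D : 'I_m -> C) (g : forall j, mor (D j) Y),
    covering J g /\ forall j, has_section_along f (g j).

Definition msec_cover (C : category) (J : quasi_topology C) (X Y : C)
    (f : mor X Y) (m : nat) : Prop :=
  exists (D : 'I_m -> C) (g : forall j, mor (D j) Y),
    [/\ covering J g, forall j, monomorphism (g j)
      & forall j, has_section_along f (g j)].

Definition least_positive (P : nat -> Prop) : \bar int :=
  (* valued in [\bar int] for its order, with [+oo] as the value ∞ *)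
  match pselect (exists m, `[< (1 <= m)%N /\ P m >]) with
  | left exP => ((ex_minn exP)%:Z)%:E
  | right _ => +oo%E
  end.

Definition sec (C : category) (J : quasi_topology C) (X Y : C) (f : mor X Y)
    : \bar int :=
  least_positive (sec_cover J f).

Definition msec (C : category) (J : quasi_topology C) (X Y : C) (f : mor X Y)
    : \bar int :=
  least_positive (msec_cover J f).

(* Main.v *)
Require Import Defs.
From mathcomp Require Import all_boot all_order all_algebra.
From mathcomp Require Import boolp constructive_ereal.

(** Pull a covering family [g_j] of [Y], along which [f] has sections [s_j],
    back along [phi] to a family [g'_j] on [Y'], with projections [p_j].  The
    weak universal property says exactly that the [g'_j] generate the pullback
    along [phi] of the sieve generated by the [g_j], so they form a covering by
    (T2).  Since [f s_j p_j = g_j p_j = phi g'_j], the given square turns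
    [s_j p_j] into a [g'_j]-section of [f'].  True pullbacks moreover preserve
    monomorphisms. *)

Local Open Scope cat_scope.

(** Serves to turn the existence of a square over each member of a covering into a whole family of
    squares. *)
Lemma dependent_choice (I : Type) (A : I -> Type) (P : forall i, A i -> Prop) :
  (forall i, exists a, P i a) -> exists f : forall i, A i, forall i, P i (f i).
Proof. by move=> exP; exists (fun i => sval (cid (exP i))) => i; case: cid. Qed.

Lemma eq_sieve (C : category) (X : C) (S T : sieve X) :
  (forall (D : C) (f : mor D X), in_sieve S f <-> in_sieve T f) -> S = T.
Proof.
case: S T => [S clS] [T clT] /= eqST.
have {}eqST : S = T.
  by apply: functional_extensionality_dep => D; apply/funext => f; apply/propext.
by subst T; congr Sieve; exact: Prop_irrelevance.
Qed.

Lemma pullback_weak_pullback (C : category) (X' X Y' Y : C)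
    (phi' : mor X' X) (f' : mor X' Y') (f : mor X Y) (phi : mor Y' Y) :
  pullback phi' f' f phi -> weak_pullback phi' f' f phi.
Proof.
case=> eqsq univ; split=> // Z a b /univ [h [hP _]].
by exists h.
Qed.

Lemma pullback_monomorphism (C : category) (X' X Y' Y : C)
    (phi' : mor X' X) (f' : mor X' Y') (f : mor X Y) (phi : mor Y' Y) :
  pullback phi' f' f phi -> monomorphism f -> monomorphism f'.
Proof.
case=> eqsq univ monof Z a b eq_ab.
have eq_ab' : phi' ∘ a = phi' ∘ b.
  by apply: monof; rewrite !mcompA eqsq -!mcompA eq_ab.
have comm : phi ∘ (f' ∘ b) = f ∘ (phi' ∘ b) by rewrite !mcompA eqsq.
(* Both [a] and [b] mediate the cone formed by [f' ∘ b] and [phi' ∘ b], so uniqueness identifies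
   them. *)
have [h [_ uniqh]] := univ _ _ _ comm.
by rewrite -(uniqh a) // -(uniqh b).
Qed.

Lemma generated_sieve_weak_pullback (C : category) (Y' Y : C) (phi : mor Y' Y)
    (I : Type) (D D' : I -> C) (g : forall i, mor (D i) Y)
    (p : forall i, mor (D' i) (D i)) (g' : forall i, mor (D' i) Y') :
  (forall i, weak_pullback (p i) (g' i) (g i) phi) ->
  generated_sieve g' = pullback_sieve phi (generated_sieve g).
Proof.
move=> wpb; apply: eq_sieve => E k; split=> [[i [l ->]]|[i [l eql]]].
  by have [eqi _] := wpb i; exists i, (p i ∘ l); rewrite !mcompA eqi.
(* The equation [phi ∘ k = g i ∘ l] makes [k] and [l] a cone over the [i]-th square, so [k] factors
   through [g' i]. *)
have [_ univ] := wpb i; have [h [<- _]] := univ _ _ _ eql.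
by exists i, h.
Qed.

Lemma covering_weak_pullback (C : category) (J : quasi_topology C) (Y' Y : C)
    (phi : mor Y' Y) (I : Type) (D D' : I -> C) (g : forall i, mor (D i) Y)
    (p : forall i, mor (D' i) (D i)) (g' : forall i, mor (D' i) Y') :
  (forall i, weak_pullback (p i) (g' i) (g i) phi) ->
  covering J g -> covering J g'.
Proof.
move=> wpb.
rewrite /covering (generated_sieve_weak_pullback _ _ _ _ _ _ _ _ _ _ wpb).
exact: covering_pullback.
Qed.

Lemma has_section_along_weak_pullback (C : category) (X' X Y' Y D D' : C)
    (phi' : mor X' X) (f' : mor X' Y') (f : mor X Y) (phi : mor Y' Y)
    (g : mor D Y) (p : mor D' D) (g' : mor D' Y') :
  weak_pullback phi' f' f phi -> g ∘ p = phi ∘ g' ->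
  has_section_along f g -> has_section_along f' g'.
Proof.
move=> [_ univ] eqg [s fs].
(* The cone [g'], [s ∘ p] lifts to [X']; the [f'] component of the lift is the section equation. *)
have comm : phi ∘ g' = f ∘ (s ∘ p) by rewrite mcompA fs eqg.
by have [h [f'h _]] := univ _ _ _ comm; exists h.
Qed.

Lemma sec_cover_weak_pullback (C : category) (J : quasi_topology C)
    (X' X Y' Y : C) (phi' : mor X' X) (f' : mor X' Y') (f : mor X Y)
    (phi : mor Y' Y) (m : nat) :
  has_weak_pullbacks C -> weak_pullback phi' f' f phi ->
  sec_cover J f m -> sec_cover J f' m.
Proof.
move=> wpbC sq [D [g [covg secg]]].
(* Apexes, projections and pulled-back maps are chosen in turn, as the types of the latter two
   depend on the apexes. *)
have [D' /dependent_choice [p /dependent_choice [g' wpb]]] :=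
  dependent_choice _ _ _ (fun j => wpbC _ _ _ (g j) phi).
exists D', g'; split=> [|j]; first exact: covering_weak_pullback wpb covg.
have [eqg _] := wpb j.
exact: has_section_along_weak_pullback sq eqg (secg j).
Qed.

Lemma msec_cover_weak_pullback (C : category) (J : quasi_topology C)
    (X' X Y' Y : C) (phi' : mor X' X) (f' : mor X' Y') (f : mor X Y)
    (phi : mor Y' Y) (m : nat) :
  has_pullbacks C -> weak_pullback phi' f' f phi ->
  msec_cover J f m -> msec_cover J f' m.
Proof.
move=> pbC sq [D [g [covg monog secg]]].
have [D' /dependent_choice [p /dependent_choice [g' pb]]] :=
  dependent_choice _ _ _ (fun j => pbC _ _ _ (g j) phi).
exists D', g'; split=> [|j|j].
- apply: covering_weak_pullback covg => j.
  exact: pullback_weak_pullback (pb j).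
- exact: pullback_monomorphism (pb j) (monog j).
- have [eqg _] := pb j.
  exact: has_section_along_weak_pullback sq eqg (secg j).
Qed.

(** Enlarging a set of positive integers can only lower its minimum, the empty set having minimum
    [+oo]. *)
Lemma le_least_positive (P Q : nat -> Prop) :
  (forall m, P m -> Q m) -> (least_positive Q <= least_positive P)%E.
Proof.
move=> PQ; rewrite /least_positive.
case: pselect => [exQ|nexQ]; case: pselect => [exP|_]; rewrite ?leey //; last first.
  (* An infinite value for [Q] against a finite one for [P] is impossible: a witness for [P] is one
     for [Q]. *)
  case: nexQ; have [m /asboolP [m_gt0 /PQ Qm]] := exP.
  by exists m; apply/asboolP.
rewrite lee_fin lez_nat; case: (ex_minnP exP) => m /asboolP [m_gt0 /PQ Qm] _.
by case: ex_minnP => n _; apply; apply/asboolP.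
Qed.

Theorem theorem3p25 (C : category) (J : quasi_topology C)
    (X' X Y' Y : C) (phi' : mor X' X) (f' : mor X' Y')
    (f : mor X Y) (phi : mor Y' Y)
    (hC : has_weak_pullbacks C)
    (hsq : weak_pullback phi' f' f phi) :
  (sec J f' <= sec J f)%E /\
  (has_pullbacks C -> (msec J f' <= msec J f)%E).
Proof.
split=> [|pbC]; apply: le_least_positive => m.
- exact: sec_cover_weak_pullback hC hsq.
- exact: msec_cover_weak_pullback pbC hsq.
Qed.
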